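(* Assume conditions (C1), (C2), (C3) listed in the context, with $\nu\in[0,\infty)$ the constant in (C2), and assume one of the following: (i) for some $K\in\mathbb{N}$ there are $\lambda_1,\ldots,\lambda_K\in[0,\infty)$ with $\lim_{n\to\infty}\frac{m_{n,k}}{k!(1-\overline{f}_n)}=\lambda_k$ for $k=1,\ldots,K$, and $\lambda_K=0$; or (ii) there are $\lambda_k\in[0,\infty)$, $k=1,2,\ldots$, with $\lim_{n\to\infty}\frac{m_{n,k}}{k!(1-\overline{f}_n)}=\lambda_k$ for all $k\ge1$, and $\limsup_{n\to\infty}\lambda_n^{1/n}\le\frac12$. Let $f_Y$ be the generating function of the limit in distribution $Y$ of the Galton--Watson process in varying environment with immigration $(Y_n)$, that is, \[ f_Y(s)=\exp\left\{-\sum_{k}\frac{2^k\lambda_k}{\nu^k}\left(\log\left(1+\frac{\nu}{2}(1-s)\right)+\sum_{i=1}^{k-1}(-1)^i\frac{\nu^i}{i\,2^i}(1-s)^i\right)\right\},\qquad s\in[0,1], \] where the sum over $k$ runs over $1\le k\le K-1$ in case (i) and over all $k\ge1$ in case (ii). Then \[ f_Y(s)=\exp\left\{\sum_{n=1}^\infty A_n(s^n-1)\right\},\qquad s\in[0,1], \] where \[ A_n=\frac{\nu^n}{n(2+\nu)^n}\sum_{j=1}^\infty q_j\left[\left(1+\frac{2}{\nu}\right)^{\min(j,n)}-1\right],\qquad n\ge1, \] and \[ q_j=\lim_{n\to\infty}\frac{\mathbf{P}(\varepsilon_n=j)}{1-\overline{f}_n},\qquad j=1,2,\ldots \] (these limits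 exist). For $\nu=0$ the expressions are understood as limits as $\nu\downarrow0$ of the individual summands, i.e. $f_Y(s)=\exp\{\sum_k(-1)^k\frac{\lambda_k}{k}(1-s)^k\}$ and $A_n=\frac1n\sum_{j=n}^\infty q_j$.
   Context: Let $\mathbb{N}=\{1,2,\ldots\}$. Let $\{\xi_{n,j},\varepsilon_n\}_{n,j\in\mathbb{N}}$ be independent nonnegative integer-valued random variables such that for each $n$ the variables $\xi_n,\xi_{n,1},\xi_{n,2},\ldots$ are identically distributed. Define $Y_0=0$ and $Y_n=\sum_{j=1}^{Y_{n-1}}\xi_{n,j}+\varepsilon_n$ for $n\in\mathbb{N}$. Let $f_n(s)=\mathbf{E}\,s^{\xi_n}$, $s\in[0,1]$, be the offspring generating function of generation $n$, and $\overline{f}_n=f_n'(1)=\mathbf{E}\,\xi_n$; $f_n''(1)=\mathbf{E}[\xi_n(\xi_n-1)]$ and $f_n'''(1)=\mathbf{E}[\xi_n(\xi_n-1)(\xi_n-2)]$. The factorial moments of the immigration are $m_{n,k}=\mathbf{E}[\varepsilon_n(\varepsilon_n-1)\cdots(\varepsilon_n-k+1)]$, $k\in\mathbb{N}$. Conditions: (C1) $\overline{f}_n<1$ for all $n$, $\lim_{n\to\infty}\overline{f}_n=1$, and $\sum_{n=1}^\infty(1-\overline{f}_n)=\infty$. (C2) $\lim_{n\to\infty}\frac{f_n''(1)}{1-\overline{f}_n}=\nu\in[0,\infty)$. (C3) if $\nu>0$, then $\lim_{n\to\infty}\frac{f_n'''(1)}{1-\overline{f}_n}=0$. Under these hypotheses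 $Y_n$ converges in distribution to a random variable $Y$ with generating function $f_Y(s)=\mathbf{E}\,s^Y$ given by the first displayed formula of the claim. Empty sums are $0$. *)

(* Defs.v *)
From HB Require Import structures.
From mathcomp Require Import all_boot all_order all_algebra.
From mathcomp Require Import all_classical all_reals all_analysis.
Import Order.TTheory GRing.Theory Num.Theory.
Import numFieldTopology.Exports numFieldNormedType.Exports.

Set Implicit Arguments.
Unset Strict Implicit.
Unset Printing Implicit Defensive.

Local Open Scope classical_set_scope.
Local Open Scope ring_scope.

Section Probability.
Context {d : measure_display} {T : measurableType d} {R : realType}.
Variable P : probability T R.

(* Every subset of nat is measurable, so the A i range over all events. *)
Definition mutually_independent (I : choiceType) (D : set I)
    (X : I -> {RV P >-> nat}) : Prop :=
  forall J : seq I, uniq J -> (forall i, i \in J -> D i) ->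
  forall A : I -> set nat,
    P (\bigcap_(i in [set` J]) (X i @^-1` A i)) =
    (\prod_(i <- J) P (X i @^-1` A i))%E.

Definition same_law (X X' : {RV P >-> nat}) : Prop :=
  forall A : set nat, P (X @^-1` A) = P (X' @^-1` A).

(* E[X (X - 1) ... (X - k + 1)], possibly +oo. *)
Definition factorial_moment (X : T -> nat) (k : nat) : \bar R :=
  'E_P[fun w => (X w ^_ k)%:R]%E.

Definition pgf (X : T -> nat) (s : R) : \bar R := 'E_P[fun w => (s ^+ X w)%R]%E.

End Probability.

Definition cvg_in_law {d} {T : measurableType d} {R : realType}
    (P : probability T R) (X : nat -> T -> nat)
    {d'} {T' : measurableType d'} (Q : probability T' R) (Z : T' -> nat) : Prop :=
  forall h : R -> R, continuous h -> (exists M : R, forall x, `|h x| <= M) ->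
    ('E_P[fun w => h (X n w)%:R] @[n --> \oo] --> 'E_Q[fun w => h (Z w)%:R])%E.

Section Process.
Context {d : measure_display} {T : measurableType d} {R : realType}.
Variable P : probability T R.

(* Generations and individuals are numbered from 1: the values xi n j with
   n = 0 or j = 0, and eps 0, are never used. *)
Fixpoint gw_process (xi : nat -> nat -> T -> nat) (eps : nat -> T -> nat)
    (n : nat) (w : T) : nat :=
  if n is m.+1 then
    (\sum_(1 <= j < (gw_process xi eps m w).+1) xi n j w + eps n w)%N
  else 0%N.

Definition gw_family (xi : nat -> nat -> {RV P >-> nat})
    (eps : nat -> {RV P >-> nat}) (i : nat * nat + nat) : {RV P >-> nat} :=
  match i with inl (n, j) => xi n j | inr n => eps n end.

Definition gw_index : set (nat * nat + nat) :=
  [set i | match i with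
           | inl (n, j) => (1 <= n)%N && (1 <= j)%N
           | inr n => (1 <= n)%N
           end].

(* xi0 n has the common law of the offspring numbers xi n 1, xi n 2, ... *)
Definition gw_data (xi0 : nat -> {RV P >-> nat})
    (xi : nat -> nat -> {RV P >-> nat}) (eps : nat -> {RV P >-> nat}) : Prop :=
  mutually_independent gw_index (gw_family xi eps) /\
  forall n j, (1 <= n)%N -> (1 <= j)%N -> same_law (xi n j) (xi0 n).

Variable xi0 : nat -> {RV P >-> nat}.

Definition offspring_mean (n : nat) : \bar R := 'E_P[fun w => (xi0 n w)%:R]%E.

(* Used only when offspring_mean n < 1, where fine is harmless. *)
Definition mean_defect (n : nat) : R := 1 - fine (offspring_mean n).

Definition condC1 : Prop :=
  [/\ forall n, (1 <= n)%N -> (offspring_mean n < 1)%E,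
      offspring_mean n @[n --> \oo] --> 1%E
    & (\sum_(1 <= n <oo) (mean_defect n)%:E = +oo)%E].

Definition condC2 (nu : R) : Prop :=
  0 <= nu /\
  (factorial_moment P (xi0 n) 2 * ((mean_defect n)^-1)%:E)%E
    @[n --> \oo] --> nu%:E.

Definition condC3 (nu : R) : Prop :=
  0 < nu ->
  (factorial_moment P (xi0 n) 3 * ((mean_defect n)^-1)%:E)%E
    @[n --> \oo] --> 0%E.

Variable eps : nat -> {RV P >-> nat}.

Definition immigration_limit (k : nat) (l : R) : Prop :=
  0 <= l /\
  (factorial_moment P (eps n) k * ((k`!%:R * mean_defect n)^-1)%:E)%E
    @[n --> \oo] --> l%:E.

(* Some K: finitely many limits lam 1, ..., lam K, with lam K = 0.
   None: limits of all orders, with a growth condition. *)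
Definition immigration_cond (K : option nat) (lam : nat -> R) : Prop :=
  match K with
  | Some K => [/\ (1 <= K)%N,
                  forall k, (1 <= k <= K)%N -> immigration_limit k (lam k)
                & lam K = 0]
  | None => (forall k, (1 <= k)%N -> immigration_limit k (lam k)) /\
            (limn_esup (fun n => (lam n `^ n%:R^-1)%:E) <= (2^-1)%:E)%E
  end.

End Process.

Section LimitLaw.
Context {R : realType}.
Variable nu : R.

(* For nu = 0: the limit as nu decreases to 0. *)
Definition limit_term (lam : nat -> R) (s : R) (k : nat) : R :=
  if nu == 0 then - ((-1) ^+ k * (lam k / k%:R) * (1 - s) ^+ k)
  else 2 ^+ k * lam k / nu ^+ k *
       (ln (1 + nu / 2 * (1 - s)) +
        \sum_(1 <= i < k)
          (-1) ^+ i * (nu ^+ i / (i%:R * 2 ^+ i)) * (1 - s) ^+ i).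

Definition limit_partial_sum (lam : nat -> R) (s : R) (N : nat) : R :=
  \sum_(1 <= k < N) limit_term lam s k.

Definition limit_pgf (K : option nat) (lam : nat -> R) (s : R) : R :=
  expR (- match K with
          | Some K => limit_partial_sum lam s K
          | None => limn (limit_partial_sum lam s)
          end).

(* For nu = 0: the limit as nu decreases to 0. The sums are taken in \bar R,
   which gives them a value without presupposing summability (here q >= 0). *)
Definition limit_coef (q : nat -> R) (n : nat) : \bar R :=
  if nu == 0 then ((n%:R^-1)%:E * \sum_(n <= j <oo) (q j)%:E)%E
  else ((nu ^+ n / (n%:R * (2 + nu) ^+ n))%:E *
        \sum_(1 <= j <oo) (q j * ((1 + 2 / nu) ^+ minn j n - 1))%:E)%E.

(* The terms are nonpositive for 0 <= s <= 1, and expeR -oo = 0, so that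
   equality with a positive real number entails convergence of the series. *)
Definition limit_exp_series (q : nat -> R) (s : R) : \bar R :=
  expeR (\sum_(1 <= n <oo) limit_coef q n * (s ^+ n - 1)%:E)%E.

End LimitLaw.

(* Main.v *)
Require Import Defs.
From HB Require Import structures.
From mathcomp Require Import all_boot all_order all_algebra.
From mathcomp Require Import all_classical all_reals all_analysis.
From mathcomp Require Import measurable_realfun ring lra zify.
Import Order.TTheory GRing.Theory Num.Theory.
Import numFieldTopology.Exports numFieldNormedType.Exports.
Set Implicit Arguments.
Unset Strict Implicit.
Unset Printing Implicit Defensive.
Local Open Scope classical_set_scope.
Local Open Scope ring_scope.

(* Put c = nu/2 and x = 1 - s. The k-th term of the exponent is lam_k T_k with
   T_k = (-1)^(k-1) times the integral of y^(k-1) / (1 + c y) over [0, x], and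
   the scaled masses p_n(j) = P(eps_n = j) / (1 - E xi_n) have binomial moments
   sum_j C(j,k) p_n(j) converging to lam_k. Bonferroni's inequalities make
   p_n(j) Cauchy as soon as C(m,j) lam_m becomes small, and convergence of the
   (k+1)-st moment gives uniform integrability for the k-th one, so that
   lam_k = sum_j C(j,k) q_j. Then sum_k lam_k T_k is the sum over j of q_j times
   sum_(k <= j) C(j,k) T_k, which is the integral of (1 - t^j) / (1 - t) divided
   by 1 + c - c t over [s, 1]; expanding both quotients in powers of t and
   interchanging the sums of nonnegative terms gives sum_n A_n (1 - s^n).
   No integral is needed: the integrals satisfy two-term recurrences, and only
   the logarithmic series, through its Lagrange remainder, is analytic. *)

(** * The logarithmic series *)

Section LogRemainder.
Context {R : realType}.
Implicit Types (u v : R) (k : nat).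

(** Taylor remainder of the logarithm at 1: the i-th Taylor term has sign (-1)^(i-1), so adding it
    with sign (-1)^i subtracts it. *)
Definition ln1p_rem k u : R :=
  ln (1 + u) + \sum_(1 <= i < k) (-1) ^+ i * (u ^+ i / i%:R).

Lemma ln1p_remS k u : (0 < k)%N ->
  ln1p_rem k.+1 u = ln1p_rem k u + (-1) ^+ k * (u ^+ k / k%:R).
Proof. by move=> k0; rewrite /ln1p_rem big_nat_recr//= addrA. Qed.

Lemma ln1p_rem0 k : ln1p_rem k 0 = 0.
Proof.
rewrite /ln1p_rem addr0 ln1 add0r big_nat big1// => i /andP[i0 _].
by rewrite expr0n gtn_eqF// mul0r mulr0.
Qed.

(** The derivative is 1 / (1 + u) minus a finite geometric sum, which leaves (-u)^k / (1 + u). *)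
Lemma is_derive_ln1p_rem k u : -1 < u ->
  is_derive u 1 (ln1p_rem k.+1) ((-1) ^+ k * (u ^+ k / (1 + u))).
Proof.
move=> u1; have u0 : 0 < 1 + u by rewrite -ltrBlDl sub0r.
elim: k => [|k IH].
  rewrite (_ : ln1p_rem 1 = @ln R \o (+%R 1)); last first.
    by apply/funext => v; rewrite /ln1p_rem big_geq// addr0.
  apply: is_derive_eq; first exact: is_derive1_comp (is_derive1_ln u0) _.
  by rewrite !expr0 !mul1r add0r mulr1.
rewrite (_ : ln1p_rem k.+2 =
    ln1p_rem k.+1 + (((-1) ^+ k.+1 / k.+1%:R) \*: (id ^+ k.+1))); last first.
  apply/funext => v; rewrite ln1p_remS//= !fctE/= /GRing.scale/=.
  by congr (_ + _); ring.
apply: is_derive_eq; rewrite /= /GRing.scale/= !exprS.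
have k0 : 0 <= k%:R :> R by [].
by field; apply/andP; split; lra.
Qed.

(** The mean value theorem between [u] and 0, where the remainder vanishes. The lower bound on [v]
    keeps [1 + v] positive for either sign of [u]. *)
Lemma ln1p_rem_mvt k u : -1 < u ->
  exists v, [/\ `|v| <= `|u|, Num.min 0 u <= v &
    ln1p_rem k.+1 u = (-1) ^+ k * (v ^+ k / (1 + v)) * u].
Proof.
move=> u1.
have cont a b : -1 < a -> {within `[a, b], continuous (ln1p_rem k.+1)}.
  move=> a1; apply: derivable_within_continuous => v.
  rewrite in_itv/= => /andP[av _].
  by have [] := @is_derive_ln1p_rem k v (lt_le_trans a1 av).
have [u0|u0] := leP 0 u.
  have [|//|v] := MVT_segment u0
    (df := fun v => (-1) ^+ k * (v ^+ k / (1 + v))) _ (cont 0 u _).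
  - move=> v; rewrite in_itv/= => /andP[v0 _].
    by apply: is_derive_ln1p_rem; lra.
  rewrite in_itv/= => /andP[v0 vu]; rewrite ln1p_rem0 !subr0 => ->.
  by exists v; split => //; rewrite ger0_norm// ger0_norm.
have [|//|v] := MVT_segment (ltW u0)
  (df := fun v => (-1) ^+ k * (v ^+ k / (1 + v))) _ (cont u 0 _).
- move=> v; rewrite in_itv/= => /andP[v0 _].
  by apply: is_derive_ln1p_rem; lra.
rewrite in_itv/= => /andP[v0 vu]; rewrite ln1p_rem0 !sub0r mulrN => /oppr_inj ->.
by exists v; split => //; rewrite ler0_norm// ler0_norm ?lerN2// ltW.
Qed.

Lemma norm_ln1p_rem_ge0 k u : 0 <= u -> `|ln1p_rem k.+1 u| <= u ^+ k.+1.
Proof.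
move=> u0; have [|v [vu v0 ->]] := @ln1p_rem_mvt k u; first by lra.
rewrite min_l// in v0; rewrite !ger0_norm// in vu.
rewrite !normrM normrX normrN1 expr1n mul1r normfV exprSr ger0_norm ?exprn_ge0//.
rewrite (ger0_norm u0) ger0_norm ?addr_ge0// ler_wpM2r//.
rewrite ler_pdivrMr; last by lra.
apply: le_trans (_ : u ^+ k * 1 <= _); first by rewrite mulr1 lerXn2r.
by rewrite ler_wpM2l ?exprn_ge0// lerDl.
Qed.

Lemma norm_ln1p_rem_le0 k u : -1 < u <= 0 ->
  `|ln1p_rem k.+1 u| <= `|u| ^+ k.+1 / (1 + u).
Proof.
move=> /andP[u1 u0]; have [v [vu v0 ->]] := @ln1p_rem_mvt k u u1.
rewrite min_r// in v0.
rewrite !normrM !normrX normrN1 expr1n mul1r normfV exprSr.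
rewrite [leRHS]mulrAC ler_wpM2r//.
rewrite (@ger0_norm _ (1 + v)); last by lra.
rewrite ler_pM// ?exprn_ge0// ?invr_ge0//; first by lra.
  by rewrite lerXn2r.
by rewrite lef_pV2 ?posrE; lra.
Qed.

End LogRemainder.

(** * The terms of the exponent *)

Section BasicTerms.
Context {R : realType}.
Implicit Types (c x s u : R) (k j n : nat).

(* The integral of (-1)^(k-1) y^(k-1) / (1 + c y) over [0, x]. *)
Definition basic_term c x k : R :=
  if c == 0 then - ((- x) ^+ k / k%:R) else ln1p_rem k (c * x) / c ^+ k.

Lemma limit_termE (nu : R) (lam : nat -> R) s k :
  limit_term nu lam s k = lam k * basic_term (nu / 2) (1 - s) k.
Proof.
rewrite /limit_term /basic_term mulf_eq0 invr_eq0 pnatr_eq0/= orbF.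
case: eqP => [_|/eqP nu0]; first by rewrite [(- (1 - s)) ^+ k]exprNn; ring.
have -> : \sum_(1 <= i < k) (-1) ^+ i * (nu ^+ i / (i%:R * 2 ^+ i)) *
    (1 - s) ^+ i =
    \sum_(1 <= i < k) (-1) ^+ i * ((nu / 2 * (1 - s)) ^+ i / i%:R).
  apply: eq_bigr => i _.
  by rewrite !exprMn exprVn invfM; ring.
by rewrite /ln1p_rem expr_div_n invf_div; field; rewrite expf_neq0.
Qed.

(** For the integrals this is c y^k / (1 + c y) = y^(k-1) - y^(k-1) / (1 + c y). Keeping the factor
    [c] on the left covers c = 0 as well. *)
Lemma basic_termS c x k : (0 < k)%N ->
  c * basic_term c x k.+1 = basic_term c x k + (- x) ^+ k / k%:R.
Proof.
move=> k0; rewrite /basic_term; case: eqP => [->|/eqP c0].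
  by rewrite mul0r addNr.
rewrite ln1p_remS// [(- x) ^+ k]exprNn exprMn exprS; field.
by rewrite pnatr_eq0 -lt0n k0 expf_neq0 ?c0.
Qed.

Lemma norm_basic_term_le1 c x k : 0 <= c -> 0 <= x <= 1 -> (0 < k)%N ->
  `|basic_term c x k| <= 1.
Proof.
case: k => // k c0 /andP[x0 x1] _; rewrite /basic_term; case: eqP => [_|/eqP c0'].
  rewrite normrN normrM normrX normrN normfV normr_nat ger0_norm//.
  by rewrite ler_pdivrMr// mul1r (le_trans (exprn_ile1 _ x0 x1))// ler1n.
have {c0 c0'} c0 : 0 < c by rewrite lt0r c0'.
rewrite normrM normfV normrX (gtr0_norm c0) ler_pdivrMr ?exprn_gt0// mul1r.
apply: le_trans (norm_ln1p_rem_ge0 _ _) _; first by rewrite mulr_ge0// ltW.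
by rewrite exprMn ler_piMr ?exprn_ile1// exprn_ge0// ltW.
Qed.

(* The integral of t^j / (1 + c - c t) over [1 - x, 1]. *)
Definition binomial_term c x j : R :=
  \sum_(k < j.+1) 'C(j, k)%:R * basic_term c x k.+1.

(** Pascal's rule; for the integrals, (1 - t^j) / (1 - t) is the sum of t^i over i < j. *)
Lemma sum_binomial_term c x j :
  \sum_(k < j) 'C(j, k.+1)%:R * basic_term c x k.+1 =
  \sum_(i < j) binomial_term c x i.
Proof.
elim: j => [|j IH]; first by rewrite !big_ord0.
rewrite [RHS]big_ord_recr/= -IH /binomial_term.
under eq_bigr do rewrite binS natrD mulrDl.
by rewrite big_split/= big_ord_recr/= bin_small// mul0r addr0.
Qed.

(** For the integrals this is c t^(j+1) / (1 + c - c t) = (1 + c) t^j / (1 + c - c t) - t^j. *)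
Lemma binomial_termS c s j :
  c * binomial_term c (1 - s) j.+1 =
  (1 + c) * binomial_term c (1 - s) j - (1 - s ^+ j.+1) / j.+1%:R.
Proof.
set T := basic_term c (1 - s).
have -> : binomial_term c (1 - s) j.+1 =
    binomial_term c (1 - s) j + \sum_(k < j.+1) 'C(j, k)%:R * T k.+2.
  rewrite /binomial_term big_ord_recl/= bin0 -/T.
  under eq_bigr do rewrite /bump/= add1n binS natrD mulrDl.
  rewrite big_split/= big_ord_recr/= bin_small// mul0r addr0 addrA.
  by rewrite [in RHS]big_ord_recl/= bin0.
rewrite mulrDr mulrDl mul1r [RHS]addrAC [RHS]addrC; congr (_ + _).
(* Expand s = 1 - (1 - s) binomially and absorb the denominator: C(j+1, k+1) / (j+1) = C(j, k) /
   (k+1). *)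
have -> : (1 - s ^+ j.+1) / j.+1%:R =
    - \sum_(k < j.+1) 'C(j, k)%:R * ((- (1 - s)) ^+ k.+1 / k.+1%:R).
  have -> : s ^+ j.+1 = (1 + - (1 - s)) ^+ j.+1 by congr (_ ^+ _); ring.
  rewrite exprDn big_ord_recl/=.
  rewrite subn0 expr0 expr1n mulr1 bin0 opprD addNKr mulNr mulr_suml.
  congr (- _); apply: eq_bigr => k _.
  rewrite /bump/= add1n expr1n mul1r -mulr_natr.
  have /(congr1 (fun n => n%:R : R)) := mul_bin_diag j.+1 k.
  rewrite !natrM/= => e.
  apply: (@mulfI _ (j.+1%:R * k.+1%:R)); first by rewrite mulf_neq0 ?pnatr_eq0.
  transitivity ((- (1 - s)) ^+ k.+1 * (k.+1%:R * 'C(j.+1, k.+1)%:R)).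
    by field; rewrite addrC natr1 pnatr_eq0.
  by rewrite -e; field; rewrite addrC natr1 pnatr_eq0.
rewrite opprK mulr_sumr -big_split/=; apply: eq_bigr => k _.
by rewrite -mulrDr -basic_termS// mulrCA.
Qed.

(** 1 / (1 + c - c t) is the geometric series in [ratio c] t, divided by 1 + c. *)
Definition ratio c : R := c / (1 + c).

Lemma ratio_lt1 c : 0 <= c -> 0 <= ratio c < 1.
Proof. by move=> c0; rewrite /ratio divr_ge0/= ?ltr_pdivrMr; lra. Qed.

(* The contribution of t^(n-1) to the integral of t^i / (1 + c - c t) over
   [s, 1]. *)
Definition power_term c s i n : R :=
  if (i < n)%N then ratio c ^+ (n.-1 - i) / (1 + c) * ((1 - s ^+ n) / n%:R)
  else 0.

Lemma power_term_ge0 c s i n : 0 <= c -> 0 <= s <= 1 -> 0 <= power_term c s i n.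
Proof.
move=> c0 /andP[s0 s1]; have /andP[r0 _] := ratio_lt1 c0.
rewrite /power_term; case: ifP => // _.
by rewrite !mulr_ge0 ?invr_ge0 ?exprn_ge0// ?subr_ge0 ?exprn_ile1//; lra.
Qed.

(** Termwise counterpart of [binomial_termS]: passing from i to i + 1 removes one factor [ratio c]
    and the contribution n = i + 1. *)
Lemma power_termS c s i n : 0 <= c ->
  c * power_term c s i.+1 n =
  (1 + c) * (power_term c s i n - power_term c s i n *+ (n == i.+1)).
Proof.
move=> c0; rewrite /power_term; case: eqP => [->|/eqP ni].
  by rewrite ltnn subrr !mulr0.
rewrite subr0 [(i < n)%N]leq_eqVlt eq_sym (negbTE ni)/=.
case: ltnP => [i1n|_]; last by rewrite !mulr0.
have -> : (n.-1 - i = (n.-1 - i.+1).+1)%N.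
  by case: n i1n {ni} => // n; rewrite ltnS => ?; rewrite subnSK.
rewrite exprS /ratio; field.
by rewrite pnatr_eq0 -lt0n (leq_ltn_trans _ i1n)//=; lra.
Qed.

Lemma cvg_ln1p_rem u : 0 <= u < 1 -> ln1p_rem n (- u) @[n --> \oo] --> 0.
Proof.
move=> /andP[u0 u1]; apply/cvgr0Pnorm_le => /= e e0.
have gc : geometric (1 - u)^-1 u n @[n --> \oo] --> 0.
  by apply: cvg_geometric; rewrite ger0_norm.
have [N _ HN] := cvgr0_norm_le _ gc e e0.
exists N.+1 => // n Nn; case: n Nn => // n Nn /=.
apply: le_trans (norm_ln1p_rem_le0 _ _) _; first by lra.
rewrite normrN (ger0_norm u0) mulrC.
apply: le_trans (_ : `|geometric (1 - u)^-1 u n.+1| <= _).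
  by rewrite /= ler_norm.
by apply: HN => /=; rewrite ltnW.
Qed.

(** Induction on i: both sides satisfy the same recurrence, and for i = 0 the series is a difference
    of two logarithmic series. The recurrence carries a factor [c], so c = 0 is treated apart. *)
Lemma cvg_power_term c s i : 0 <= c -> 0 <= s <= 1 ->
  \sum_(0 <= n < N) power_term c s i n @[N --> \oo] -->
    binomial_term c (1 - s) i.
Proof.
move=> c0 s01; have /andP[s0 s1] := s01.
have [c_eq0|c_neq0] := eqVneq c 0.
  (* For c = 0 the left side of the recurrence vanishes, which gives the value outright; only n = i
     + 1 contributes to the series. *)
  have -> : binomial_term c (1 - s) i = power_term c s i i.+1.
    apply: (@mulfI _ (1 + c)); first by rewrite c_eq0 addr0 oner_neq0.
    have := binomial_termS c s i; rewrite {1}c_eq0 mul0r => /esym/eqP.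
    rewrite subr_eq add0r => /eqP ->.
    rewrite /power_term ltnSn subnn expr0 c_eq0; field.
    by rewrite addrC natr1 pnatr_eq0.
  apply: cvg_near_cst; exists i.+2 => // N /= iN.
  rewrite (big_cat_nat _ (n := i.+1)) //=; last exact: ltnW.
  rewrite big_nat big1 ?add0r => [|n /andP[_ ni]]; last first.
    by rewrite /power_term ltnNge -ltnS ni.
  rewrite big_ltn// big_nat big1 ?addr0// => n /andP[ni _].
  rewrite /power_term (ltn_trans _ ni)// c_eq0 /ratio mul0r expr0n.
  rewrite subn_eq0 (_ : (n.-1 <= i)%N = false) ?mul0r//.
  by case: n ni => // n ni; rewrite leqNgt -ltnS ni.
elim: i => [|i IH].
  (* Since r^(n-1) / (1 + c) = r^n / c with r = [ratio c], the partial sums are those of the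
     logarithmic series at r and at r s. *)
  pose F N := (ln1p_rem N (- ratio c) - ln1p_rem N (- (ratio c * s)) +
     ln (1 + c * (1 - s))) / c.
  have rc := ratio_lt1 c0.
  have rs : 0 <= ratio c * s < 1.
    case/andP: rc => r0 r1; rewrite mulr_ge0//=.
    by rewrite (le_lt_trans _ r1)// ler_piMr.
  have -> : binomial_term c (1 - s) 0 = (0 - 0 + ln (1 + c * (1 - s))) / c.
    rewrite /binomial_term big_ord1 bin0 mul1r /basic_term (negbTE c_neq0).
    by rewrite /ln1p_rem big_geq// expr1; ring.
  suff -> : (fun N => \sum_(0 <= n < N) power_term c s 0 n) = F.
    apply: cvgMl; apply: cvgD; last exact: cvg_cst.
    by apply: cvgB; exact: cvg_ln1p_rem.
  have lnE : ln (1 + c * (1 - s)) = ln (1 - ratio c * s) - ln (1 - ratio c).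
    rewrite -ln_div ?posrE; [|lra..].
    by congr ln; rewrite /ratio; field; lra.
  apply/funext => N.
  have -> : \sum_(0 <= n < N) power_term c s 0 n =
      \sum_(1 <= n < N) power_term c s 0 n.
    case: N => [|N]; first by rewrite !big_geq.
    by rewrite big_ltn// /power_term ltnn add0r.
  rewrite /F /ln1p_rem lnE.
  rewrite (_ : forall a b d e, (a + b - (d + e) + (d - a)) = b - e :> R);
    last by move=> *; ring.
  apply: (@mulfI _ c) => //; rewrite mulr_sumr [RHS]mulrC divfK//.
  rewrite -sumrB; apply: eq_big_nat => -[//|n] _.
  have sg (v : R) m : (-1) ^+ m * ((- v) ^+ m / m%:R) = v ^+ m / m%:R.
    by rewrite mulrA -exprMn mulN1r opprK.
  rewrite !sg [(ratio c * s) ^+ _]exprMn ![ratio c ^+ n.+1]exprS.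
  rewrite /power_term /= subn0.
  have -> : ratio c ^+ n / (1 + c) = ratio c * ratio c ^+ n / c.
    by rewrite /ratio; field; rewrite c_neq0; lra.
  by field; rewrite addrC natr1 pnatr_eq0 c_neq0.
rewrite -[X in _ --> X](mulKf c_neq0) binomial_termS.
rewrite (_ : (fun N => _) = fun N =>
  c^-1 * (c * \sum_(0 <= n < N) power_term c s i.+1 n)); last first.
  by apply/funext => N; rewrite mulKf.
apply: cvgMr.
have -> : (1 - s ^+ i.+1) / i.+1%:R = (1 + c) * power_term c s i i.+1.
  rewrite /power_term ltnSn subnn expr0; field.
  by rewrite addrC natr1 pnatr_eq0/=; lra.
rewrite -mulrBr.
have lim : (1 + c) * (\sum_(0 <= n < N) power_term c s i n - power_term c s i i.+1)
    @[N --> \oo] --> (1 + c) * (binomial_term c (1 - s) i - power_term c s i i.+1).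
  by apply: cvgMr; apply: cvgB; [exact: IH|exact: cvg_cst].
apply: cvg_trans lim.
(* From N = i + 2 on, the partial sum contains n = i + 1, the only index with a correction in
   [power_termS]. *)
apply: near_eq_cvg; exists i.+2 => // N /= iN.
rewrite mulr_sumr; under [RHS]eq_bigr do rewrite power_termS//.
rewrite -mulr_sumr sumrB; congr (_ * (_ - _)).
rewrite (bigD1_seq i.+1) ?iota_uniq ?mem_index_iota//= eqxx big1 ?addr0// => n.
by move=> /negbTE ->.
Qed.

End BasicTerms.

(** * Interchange of summations *)

Section SeriesIdentity.
Local Open Scope ereal_scope.
Context {R : realType}.

Lemma eseries_fin (f : nat -> \bar R) (P : pred nat) N :
  (forall k, (N <= k)%N -> f k = 0) ->
  \sum_(k <oo | P k) f k = \sum_(k < N | P k) f k.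
Proof.
move=> f0; apply: lim_near_cst => //; exists N => // n /= Nn.
rewrite (big_cat_nat _ (n := N)) //= big_mkord.
rewrite [X in _ + X](_ : _ = 0) ?adde0// big_nat_cond big1// => k.
by move=> /andP[/andP[Nk _] _]; exact: f0.
Qed.

Lemma nneseriesN (f : nat -> \bar R) m : (forall k, 0 <= f k) ->
  \sum_(m <= k <oo) - f k = - \sum_(m <= k <oo) f k.
Proof.
move=> f0; rewrite -limeN; last by apply: is_cvg_nneseries.
apply/congr_lim/funext => n; rewrite sumeN// => i j _ _.
exact: ge0_adde_def (f0 i) (f0 j).
Qed.

Lemma nneseries_EFin (u : nat -> R) (l : R) m :
  (fun N => (\sum_(m <= k < N) u k)%R) @ \oo --> l ->
  \sum_(m <= k <oo) (u k)%:E = l%:E.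
Proof.
move=> ul; apply: cvg_lim => //.
by under eq_fun do rewrite sumEFin; apply: cvg_EFin => //; exact: nearW.
Qed.

Lemma cvg_nneseries_EFin (u : nat -> R) (l : R) m :
  (forall k, (m <= k)%N -> 0 <= u k)%R ->
  \sum_(m <= k <oo) (u k)%:E = l%:E ->
  (fun N => (\sum_(m <= k < N) u k)%R) @ \oo --> l.
Proof.
move=> u0 ul.
suff : (fun N => (\sum_(m <= k < N) u k)%:E) @ \oo --> l%:E by case/fine_cvgP.
rewrite -ul; under eq_fun do rewrite -sumEFin.
by apply: is_cvg_nneseries => k mk _; rewrite lee_fin u0.
Qed.

(** A geometric sum: [1 + 2 / nu] is the inverse of the ratio r = nu / (2 + nu), and 1 / (1 + nu /
    2) = 1 - r. *)
Lemma sum_power_ratio (nu : R) m n : (0 < nu)%R -> (m <= n)%N ->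
  (\sum_(i < m) ratio (nu / 2) ^+ (n.-1 - i) / (1 + nu / 2) =
   (nu / (2 + nu)) ^+ n * ((1 + 2 / nu) ^+ m - 1))%R.
Proof.
move=> nu0; have rE : ratio (nu / 2) = (nu / (2 + nu))%R.
  by rewrite /ratio; field; do ?[apply/andP; split]; lra.
elim: m => [|m IH] mn; first by rewrite big_ord0 expr0 subrr mulr0.
rewrite big_ord_recr/= IH ?(ltnW mn)// rE.
have : (n = m.+1 + (n.-1 - m))%N by lia.
move: (n.-1 - m)%N => d ->; rewrite exprD.
have e : ((nu / (2 + nu)) ^+ m.+1 * (1 + 2 / nu) ^+ m.+1 = 1 :> R)%R.
  rewrite -exprMn (_ : (_ * _ = 1)%R) ?expr1n//; field.
  by do ?[apply/andP; split]; lra.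
have e' : ((nu / (2 + nu)) ^+ m.+1 * (1 + 2 / nu) ^+ m = nu / (2 + nu) :> R)%R.
  rewrite exprS -mulrA -exprMn (_ : (nu / (2 + nu) * (1 + 2 / nu) = 1)%R).
    by rewrite expr1n mulr1.
  by field; do ?[apply/andP; split]; lra.
move: e e'; set a := (_ ^+ m.+1)%R; set b := (_ ^+ m.+1)%R; set b' := (_ ^+ m)%R.
set D := (_ ^+ d)%R => e e'.
rewrite !mulrBr (mulrAC a D b') e' (mulrAC a D b) e; field.
do ?[apply/andP; split]; lra.
Qed.

End SeriesIdentity.

(** * The exponent as a double series in the limit masses *)

Section LimitExponent.
Context {R : realType}.

(** Origin of min(j, n): the powers t^i have i < j, and t^i reaches the index n only if i < n. For
    nu = 0 only i = n - 1 survives. *)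
Lemma sum_power_term (nu s : R) j n : 0 <= nu -> (0 < n)%N ->
  \sum_(i < j) power_term (nu / 2) s i n =
  (if nu == 0 then (n <= j)%:R / n%:R
   else nu ^+ n / (n%:R * (2 + nu) ^+ n) * ((1 + 2 / nu) ^+ minn j n - 1)) *
  (1 - s ^+ n).
Proof.
move=> nu0 n0.
have -> : \sum_(i < j) power_term (nu / 2) s i n =
    (\sum_(i < minn j n) ratio (nu / 2) ^+ (n.-1 - i) / (1 + nu / 2)) *
    ((1 - s ^+ n) / n%:R).
  rewrite mulr_suml /power_term -big_mkcond/=.
  case: leqP => [jn|/ltnW nj].
    by apply: eq_bigl => i; rewrite (leq_trans _ jn).
  by rewrite (big_ord_narrow nj).
case: eqP => [->|/eqP nu_neq0].
  suff -> : \sum_(i < minn j n) ratio (0 / 2) ^+ (n.-1 - i) / (1 + 0 / 2) =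
      (n <= j)%:R :> R by ring.
  rewrite /ratio !mul0r addr0 invr1; under eq_bigr do rewrite mulr1 expr0n subn_eq0.
  case: leqP => [|jn]; last first.
    rewrite big1// => i _; rewrite (_ : (_ <= _)%N = false)//.
    by apply/negbTE; rewrite -ltnNge; have := ltn_ord i; lia.
  case: n n0 => // n _ _; rewrite big_ord_recr/= leqnn big1 ?add0r// => i _.
  by rewrite leqNgt ltn_ord.
have nu1 : 0 < nu by rewrite lt0r nu_neq0.
rewrite sum_power_ratio ?geq_minr// expr_div_n; field.
by rewrite pnatr_eq0 -lt0n n0 expf_neq0//; lra.
Qed.

Lemma limit_coef_sum (nu s : R) (q : nat -> R) n : 0 <= nu -> (0 < n)%N ->
  (forall j, 0 <= q j) -> 0 <= s <= 1 ->
  (\sum_(j <oo) (q j * \sum_(i < j) power_term (nu / 2) s i n)%:E =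
   limit_coef nu q n * (1 - s ^+ n)%:E)%E.
Proof.
move=> nu0 n0 q0 s01; rewrite /limit_coef.
under eq_eseriesr do rewrite sum_power_term//.
rewrite muleC; case: eqP => [_|/eqP nu_neq0].
  rewrite muleA -EFinM [in RHS]ereal_series [X in (_ * X)%E]eseries_mkcond.
  rewrite -nneseriesZl.
    apply: eq_eseriesr => j _; case: ifP => _; last first.
      by rewrite mul0r mul0r mulr0 mule0.
    by rewrite -EFinM; congr EFin; rewrite /=; ring.
  by move=> j _; case: ifP; rewrite ?lee_fin.
have nu1 : 0 < nu by rewrite lt0r nu_neq0.
rewrite muleA -EFinM -nneseriesZl; last first.
  move=> j _; rewrite lee_fin mulr_ge0// subr_ge0 exprn_ege1// lerDl.
  by rewrite divr_ge0.
(* The series in [limit_coef] starts at j = 1; the term j = 0 vanishes because min(0, n) = 0. *)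
rewrite nneseries_recl//; last first.
  move=> j _; rewrite lee_fin mulr_ge0//; case/andP: s01 => s0 s1.
  apply: mulr_ge0; last by rewrite subr_ge0 exprn_ile1.
  apply: mulr_ge0; last by rewrite subr_ge0 exprn_ege1// lerDl divr_ge0.
  by rewrite divr_ge0 ?mulr_ge0 ?exprn_ge0//; lra.
rewrite min0n expr0 subrr mulr0 mul0r mulr0 add0e.
by apply: eq_eseriesr => j _; rewrite -EFinM; congr EFin; rewrite /=; ring.
Qed.

(** The defining sum has terms of both signs; positivity is read off from the expansion in
    [power_term]. *)
Lemma binomial_term_ge0 (c s : R) i : 0 <= c -> 0 <= s <= 1 ->
  0 <= binomial_term c (1 - s) i.
Proof.
move=> c0 s01; have lim := cvg_power_term (i := i) c0 s01.
rewrite -(cvg_lim (@Rhausdorff R) lim); apply: limr_ge.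
  by apply/cvg_ex; exists (binomial_term c (1 - s) i).
by apply: nearW => N; apply: sumr_ge0 => n _; exact: power_term_ge0.
Qed.

(** Expand each [binomial_term] in powers and interchange the sums over j and n, all terms being
    nonnegative. *)
Lemma exponent_coef_sum (nu s : R) (q : nat -> R) : 0 <= nu ->
  (forall j, 0 <= q j) -> 0 <= s <= 1 ->
  (\sum_(j <oo) (q j * \sum_(i < j) binomial_term (nu / 2) (1 - s) i)%:E =
   \sum_(1 <= n <oo) limit_coef nu q n * (1 - s ^+ n)%:E)%E.
Proof.
move=> nu0 q0 s01; have c0 : 0 <= nu / 2 by rewrite divr_ge0.
have pt0 j n : 0 <= q j * \sum_(i < j) power_term (nu / 2) s i n.
  by rewrite mulr_ge0// sumr_ge0// => i _; exact: power_term_ge0.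
transitivity (\sum_(j <oo) \sum_(n <oo)
    (q j * \sum_(i < j) power_term (nu / 2) s i n)%:E)%E.
  apply: eq_eseriesr => j _; apply/esym/nneseries_EFin.
  rewrite (_ : (fun N => _) = fun N => q j *
      \sum_(i < j) \sum_(0 <= n < N) power_term (nu / 2) s i n); last first.
    by apply/funext => N; rewrite -mulr_sumr exchange_big.
  apply: cvgMr; apply: cvg_big => [|i _]; first exact: add_continuous.
  exact: cvg_power_term.
rewrite nneseries_interchange//.
rewrite nneseries_recl// => [|n _]; last first.
  by apply: nneseries_ge0 => j _ _; rewrite lee_fin.
rewrite eseries0 ?add0e => [|j _ _]; last first.
  by rewrite big1 ?mulr0// => i _; rewrite /power_term ltn0.
rewrite ereal_series [RHS]ereal_series.
by apply: eq_eseriesr => n n0; exact: limit_coef_sum.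
Qed.

(** Insert [lamE] and sum over k first: for each j only k <= j contribute, and [sum_binomial_term]
    identifies the inner sum. *)
Lemma exponent_lam_sum (nu s : R) (lam q : nat -> R) : 0 <= nu -> 0 <= s <= 1 ->
  (forall j, 0 <= q j) ->
  (forall k, (0 < k)%N ->
    (\sum_(j <oo) ('C(j, k)%:R * q j)%:E)%E = (lam k)%:E) ->
  (\sum_(1 <= k <oo) (lam k)%:E < +oo)%E ->
  exists2 l : R, limit_partial_sum nu lam s @ \oo --> l &
    (\sum_(j <oo) (q j * \sum_(i < j) binomial_term (nu / 2) (1 - s) i)%:E)%E
    = l%:E.
Proof.
move=> nu0 s01 q0 lamE lam_fin; have c0 : 0 <= nu / 2 by rewrite divr_ge0.
(* [T k] changes sign with k; [T k + 1 >= 0] allows Tonelli's theorem. *)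
pose T k := basic_term (nu / 2) (1 - s) k.
have s01' : 0 <= 1 - s <= 1 by lra.
have T1 k : (0 < k)%N -> `|T k| <= 1 by exact: norm_basic_term_le1.
have W0 k : (0 < k)%N -> 0 <= T k + 1 <= 2 by move=> /T1; rewrite ler_norml; lra.
have lam0 k : (0 < k)%N -> 0 <= lam k.
  move=> k0; rewrite -lee_fin -lamE//; apply: nneseries_ge0 => j _ _.
  by rewrite lee_fin mulr_ge0.
(* Tonelli for nonnegative weights, applied below to [T k + 1] and to 1. *)
have swap (w : nat -> R) : (forall k, (0 < k)%N -> 0 <= w k) ->
    (\sum_(1 <= k <oo) (lam k * w k)%:E =
     \sum_(j <oo) (q j * \sum_(k < j) 'C(j, k.+1)%:R * w k.+1)%:E)%E.
  move=> w0; rewrite ereal_series.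
  pose a k j : \bar R := if (0 < k)%N then ('C(j, k)%:R * q j * w k)%:E else 0%E.
  have a0 k j : (0 <= a k j)%E.
    by rewrite /a; case: ifP => // /w0 wk; rewrite lee_fin !mulr_ge0.
  transitivity (\sum_(k <oo | (1 <= k)%N) \sum_(j <oo) a k j)%E.
    apply: eq_eseriesr => k k0; rewrite EFinM -lamE// muleC -nneseriesZl.
      by apply: eq_eseriesr => j _; rewrite /a k0 -EFinM mulrC.
    by move=> j _; rewrite lee_fin mulr_ge0.
  rewrite nneseries_interchange//; apply: eq_eseriesr => j _.
  rewrite (@eseries_fin _ _ _ j.+1); last first.
    by move=> k jk; rewrite /a bin_small// !mul0r; case: ifP.
  rewrite big_mkcond big_ord_recl/= add0e.
  under eq_bigr => i _ do rewrite /a /bump add1n /=.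
  by rewrite sumEFin mulr_sumr; congr EFin; apply: eq_bigr => k _; ring.
have [x0 x0E] : exists x0, (\sum_(1 <= k <oo) (lam k)%:E)%E = x0%:E.
  exists (fine (\sum_(1 <= k <oo) (lam k)%:E)%E); rewrite fineK// ge0_fin_numE//.
  by apply: nneseries_ge0 => k k0 _; rewrite lee_fin lam0.
have [x1 x1E] : exists x1, (\sum_(1 <= k <oo) (lam k * (T k + 1))%:E)%E = x1%:E.
  exists (fine (\sum_(1 <= k <oo) (lam k * (T k + 1))%:E)%E).
  rewrite fineK// ge0_fin_numE//; last first.
    apply: nneseries_ge0 => k k0 _; rewrite lee_fin mulr_ge0 ?lam0//.
    by case/andP: (W0 k k0).
  apply: (@le_lt_trans _ _ (2%:E * \sum_(1 <= k <oo) (lam k)%:E)%E); last first.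
    by rewrite x0E -EFinM ltry.
  rewrite ereal_series [in leRHS]ereal_series -nneseriesZl; last first.
    by move=> k k0; rewrite lee_fin lam0.
  apply: lee_nneseries => k => [_ k0|k0].
    by rewrite lee_fin mulr_ge0 ?lam0//; case/andP: (W0 k k0).
  by rewrite -EFinM lee_fin mulrC ler_wpM2r ?lam0//; case/andP: (W0 k k0).
exists (x1 - x0).
  rewrite (_ : limit_partial_sum nu lam s = fun N =>
      \sum_(1 <= k < N) lam k * (T k + 1) - \sum_(1 <= k < N) lam k); last first.
    apply/funext => N; rewrite -sumrB; apply: eq_bigr => k _.
    by rewrite limit_termE -/(T k); ring.
  apply: cvgB; apply: cvg_nneseries_EFin => //.
    by move=> k k0; rewrite mulr_ge0 ?lam0//; case/andP: (W0 k k0).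
have x1S : (\sum_(j <oo) (q j * \sum_(k < j) 'C(j, k.+1)%:R * (T k.+1 + 1))%:E)%E
    = x1%:E.
  by rewrite -x1E (swap (fun k => T k + 1))// => k k0; case/andP: (W0 k k0).
have x0S : (\sum_(j <oo) (q j * \sum_(k < j) 'C(j, k.+1)%:R)%:E)%E = x0%:E.
  rewrite -x0E; transitivity (\sum_(1 <= k <oo) (lam k * 1)%:E)%E.
    rewrite (swap (fun=> 1))//; apply: eq_eseriesr => j _.
    by under [in RHS]eq_bigr do rewrite mulr1.
  by apply: eq_eseriesr => k _; rewrite mulr1.
(* [V] is a priori extended real; x1 = V + x0 with x0 and x1 real forces it to be finite. *)
set V := (X in X = _).
suff : (x1%:E = V + x0%:E)%E by case: V => //= r [->]; rewrite addrK.
rewrite -x1S -x0S -nneseriesD.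
- apply: eq_eseriesr => j _; rewrite -EFinD -mulrDr -sum_binomial_term -big_split/=.
  by congr (q j * _)%:E; apply: eq_bigr => k _; rewrite mulrDr mulr1.
- move=> j _ _; rewrite lee_fin mulr_ge0// sumr_ge0// => i _.
  exact: binomial_term_ge0.
- by move=> j _ _; rewrite lee_fin mulr_ge0// sumr_ge0.
Qed.

Lemma limit_pgf_series (nu : R) (lam q : nat -> R) : 0 <= nu ->
  (forall j, 0 <= q j) ->
  (forall k, (0 < k)%N ->
    (\sum_(j <oo) ('C(j, k)%:R * q j)%:E)%E = (lam k)%:E) ->
  (\sum_(1 <= k <oo) (lam k)%:E < +oo)%E ->
  forall s, 0 <= s <= 1 -> cvgn (limit_partial_sum nu lam s) /\
    (limit_pgf nu None lam s)%:E = limit_exp_series nu q s.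
Proof.
move=> nu0 q0 lamE lam_fin s s01.
have [l lim lE] := exponent_lam_sum nu0 s01 q0 lamE lam_fin.
split; first by apply/cvg_ex; exists l.
rewrite /limit_pgf (cvg_lim _ lim)// /limit_exp_series.
under eq_eseriesr => n _ do rewrite -opprB EFinN muleN.
have coef0 n : (0 <= limit_coef nu q n)%E.
  rewrite /limit_coef; case: eqP => [_|/eqP nu_neq0].
    by rewrite mule_ge0 ?lee_fin// nneseries_ge0// => j _ _; rewrite lee_fin.
  rewrite mule_ge0 ?lee_fin ?divr_ge0 ?mulr_ge0 ?exprn_ge0 ?addr_ge0//.
  apply: nneseries_ge0 => j _ _; rewrite lee_fin mulr_ge0// subr_ge0.
  by rewrite exprn_ege1// lerDl divr_ge0.
rewrite nneseriesN; last first.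
  move=> n; case/andP: s01 => s0 s1; rewrite mule_ge0// lee_fin subr_ge0.
  exact: exprn_ile1.
by rewrite -exponent_coef_sum// lE.
Qed.

End LimitExponent.

(** * Binomial moments *)

Section BinomialMoments.
Context {R : realType}.

(** For n > 0 and m > 0 the truncated alternating sum is (-1)^(m-1) C(n-1, m-1), at most C(n, m) by
    Pascal's rule. *)
Lemma norm_alt_bin_sum n m :
  `|\sum_(l < m) (-1) ^+ l * 'C(n, l)%:R - (n == 0%N)%:R| <= 'C(n, m)%:R :> R.
Proof.
case: n => [|n].
  case: m => [|m]; first by rewrite big_ord0 sub0r normrN normr1 bin0.
  rewrite big_ord_recl expr0 mul1r bin0 big1 ?addr0 ?subrr ?normr0// => i _.
  by rewrite bin0n mulr0.
rewrite subr0; case: m => [|m]; first by rewrite big_ord0 normr0 ler0n.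
have -> : \sum_(l < m.+1) (-1) ^+ l * 'C(n.+1, l)%:R =
    (-1) ^+ m * 'C(n, m)%:R :> R.
  elim: m => [|m IH]; first by rewrite big_ord1 !bin0.
  by rewrite big_ord_recr/= IH binS natrD exprS; ring.
rewrite normrM normrX normrN1 expr1n mul1r normr_nat ler_nat.
by rewrite binS leq_addl.
Qed.

(** Both sides count the chains of a j-set inside a k-set inside a fixed i-set. *)
Lemma mul_bin_bin i j k : (j <= k)%N ->
  ('C(k, j) * 'C(i, k) = 'C(i, j) * 'C(i - j, k - j))%N.
Proof.
move=> jk; have [ki|ik] := leqP k i; last first.
  rewrite ['C(i, k)]bin_small// muln0; have [ij|ji] := ltnP i j.
    by rewrite bin_small.
  by rewrite ['C(i - j, _)]bin_small ?muln0// ltn_sub2r// (leq_ltn_trans ji).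
have ji := leq_trans jk ki.
have h1 := bin_fact jk; have h2 := bin_fact ki; have h3 := bin_fact ji.
have h4 := bin_fact (leq_sub2r j ki).
apply/eqP; rewrite -(eqn_pmul2r (fact_gt0 j)) -(eqn_pmul2r (fact_gt0 (k - j))).
rewrite -(eqn_pmul2r (fact_gt0 (i - k))).
have e : (i - j - (k - j) = i - k)%N by lia.
rewrite e in h4; apply/eqP; transitivity (i`!); first by rewrite -h2 -h1; lia.
by rewrite -h3 -h4; lia.
Qed.

(** By [mul_bin_bin] a factor C(i, j) comes out, leaving the alternating sum of row i - j. *)
Lemma bonferroni i j m : (j <= m)%N ->
  `|\sum_(j <= k < m) (-1) ^+ (k - j) * 'C(k, j)%:R * 'C(i, k)%:R - (i == j)%:R|
  <= 'C(m, j)%:R * 'C(i, m)%:R :> R.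
Proof.
move=> jm.
rewrite -natrM mul_bin_bin// natrM.
have -> : (i == j)%:R = 'C(i, j)%:R * ((i - j)%N == 0%N)%:R :> R.
  rewrite subn_eq0; case: ltngtP => [ij|ij|->]; first by rewrite bin_small// mul0r.
    by rewrite mulr0.
  by rewrite binn mulr1.
have -> : \sum_(j <= k < m) (-1) ^+ (k - j) * 'C(k, j)%:R * 'C(i, k)%:R =
    'C(i, j)%:R * \sum_(l < m - j) (-1) ^+ l * 'C(i - j, l)%:R :> R.
  rewrite mulr_sumr -{1}(add0n j) big_addn big_mkord; apply: eq_bigr => l _.
  by rewrite -mulrA -natrM mul_bin_bin ?leq_addl// addnK natrM; ring.
by rewrite -mulrBr normrM normr_nat ler_wpM2l// norm_alt_bin_sum.
Qed.

Definition binomial_series (a : nat -> R) k : nat -> R :=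
  series (fun i => 'C(i, k)%:R * a i).

Lemma nondecreasing_binomial_series (a : nat -> R) k : (forall i, 0 <= a i) ->
  nondecreasing_seq (binomial_series a k).
Proof.
move=> a0 x y xy; rewrite /binomial_series nondecreasing_series// => i _ _.
by rewrite mulr_ge0.
Qed.

Definition binomial_moment (a : nat -> R) k : R := limn (binomial_series a k).

Lemma bonferroni_moment (a : nat -> R) j m : (j <= m)%N ->
  (forall i, 0 <= a i) ->
  (forall k, (j <= k <= m)%N -> cvgn (binomial_series a k)) ->
  `|\sum_(j <= k < m) (-1) ^+ (k - j) * 'C(k, j)%:R * binomial_moment a k - a j|
  <= 'C(m, j)%:R * binomial_moment a m.
Proof.
move=> jm a0 ca.
have lhs : `|\sum_(j <= k < m) (-1) ^+ (k - j) * 'C(k, j)%:R * binomial_series a k N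
    - a j| @[N --> \oo] -->
  `|\sum_(j <= k < m) (-1) ^+ (k - j) * 'C(k, j)%:R * binomial_moment a k - a j|.
  apply: cvg_norm; apply: cvgB; last exact: cvg_cst.
  rewrite big_nat_cond; under eq_cvg do rewrite big_nat_cond.
  apply: cvg_big => [|k /andP[/andP[jk km] _]]; first exact: add_continuous.
  by apply: cvgMr; apply: ca; rewrite jk ltnW.
have rhs : 'C(m, j)%:R * binomial_series a m N @[N --> \oo] -->
    'C(m, j)%:R * binomial_moment a m.
  by apply: cvgMr; apply: ca; rewrite jm leqnn.
apply: ler_cvg_to lhs rhs _.
(* From N = j + 1 on, [a j] is itself a partial sum, of [a i] against the indicator of i = j, so
   [bonferroni] applies termwise. *)
exists j.+1 => // N /= jN.
have -> : a j = \sum_(0 <= i < N) (i == j)%:R * a i.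
  rewrite (bigD1_seq j) ?iota_uniq ?mem_index_iota//= eqxx mul1r big1 ?addr0//.
  by move=> i /negbTE ->; rewrite mul0r.
rewrite /binomial_series /series/=.
under eq_bigr do rewrite mulr_sumr.
rewrite exchange_big/= -sumrB mulr_sumr.
apply: le_trans (ler_norm_sum _ _ _) _; apply: ler_sum => i _.
under eq_bigr do rewrite mulrA.
rewrite -mulr_suml -mulrBl normrM (ger0_norm (a0 i)) mulrA ler_wpM2r//.
exact: bonferroni.
Qed.

(** From (k+1) C(i, k+1) = (i-k) C(i, k): beyond N, C(i, k) is at most (k+1) / (N-k) times C(i,
    k+1). *)
Lemma binomial_moment_tail (a : nat -> R) k N : (k < N)%N ->
  (forall i, 0 <= a i) ->
  cvgn (binomial_series a k) -> cvgn (binomial_series a k.+1) ->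
  binomial_series a k N <= binomial_moment a k <=
  binomial_series a k N + k.+1%:R / (N - k)%:R * binomial_moment a k.+1.
Proof.
move=> kN a0 ck ck1.
have nd := nondecreasing_binomial_series k a0.
apply/andP; split; first exact: nondecreasing_cvgn_le.
have rhs : binomial_series a k N + k.+1%:R / (N - k)%:R * binomial_series a k.+1 M
    @[M --> \oo] -->
  binomial_series a k N + k.+1%:R / (N - k)%:R * binomial_moment a k.+1.
  by apply: cvgD; [exact: cvg_cst|apply: cvgMr].
apply: ler_cvg_to ck rhs _; exists N => // M /= NM.
rewrite {1}/binomial_series /series/= (big_cat_nat _ (n := N))//= lerD2l.
rewrite -ler_pdivrMl ?divr_gt0 ?ltr0n ?subn_gt0// invf_div mulr_sumr.
rewrite /binomial_series /series/= [leRHS](big_cat_nat _ (n := N))//=.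
rewrite ler_wpDl ?sumr_ge0//; first by move=> i _; rewrite mulr_ge0.
rewrite !big_nat; apply: ler_sum => i /andP[Ni _].
rewrite mulrA ler_wpM2r// mulrAC ler_pdivrMr ?ltr0n// -!natrM ler_nat.
by rewrite [leqRHS]mulnC mul_bin_left leq_mul2r leq_sub2r// orbT.
Qed.

(** Convergence of the series is required separately because [limn] of a divergent series is a
    default value. *)
Definition moment_cvg (p : nat -> nat -> R) k (l : R) : Prop :=
  (\forall n \near \oo, cvgn (binomial_series (p n) k)) /\
  binomial_moment (p n) k @[n --> \oo] --> l.

End BinomialMoments.

(** * Passage to the limit in masses and moments *)

Section MomentLimits.
Context {R : realType}.
Implicit Types (p : nat -> nat -> R) (lam q : nat -> R).

(** Truncated inversion of the limit moments gives a centre for the Cauchy criterion; the Bonferroni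
    error tends to C(m, j) [lam m], below [e]. *)
Lemma cvg_mass_of_moments p lam j :
  (\forall n \near \oo, forall i, 0 <= p n i) ->
  (forall e, 0 < e -> exists m, [/\ (j <= m)%N,
     forall k, (j <= k <= m)%N -> moment_cvg p k (lam k) &
     'C(m, j)%:R * lam m < e]) ->
  cvgn (p^~ j).
Proof.
move=> p0 H; apply/cauchy_cvgP/cauchy_exP => e e0.
have [m [jm mc lam_small]] := H e e0.
pose x := \sum_(j <= k < m) (-1) ^+ (k - j) * 'C(k, j)%:R * lam k.
exists x.
(* Ranging over the finite type ['I_m.+1] makes one threshold in n serve all orders k. *)
have near_cvg : \forall n \near \oo, forall k : 'I_m.+1, (j <= k)%N ->
    cvgn (binomial_series (p n) k).
  apply: filter_forall => k; have [jk|kj] := leqP j k.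
    have [|h _] := mc k; first by rewrite jk -ltnS ltn_ord.
    by apply: filterS h => n.
  by apply: nearW => n.
have lim : 'C(m, j)%:R * binomial_moment (p n) m +
   `|x - \sum_(j <= k < m) (-1) ^+ (k - j) * 'C(k, j)%:R * binomial_moment (p n) k|
   @[n --> \oo] --> 'C(m, j)%:R * lam m + `|x - x|.
  apply: cvgD.
    by apply: cvgMr; have [|_ h] := mc m; [rewrite jm leqnn|exact: h].
  apply: cvg_norm; apply: cvgB; first exact: cvg_cst.
  rewrite /x big_nat_cond; under eq_cvg do rewrite big_nat_cond.
  apply: cvg_big => [|k /andP[/andP[jk km] _]]; first exact: add_continuous.
  by apply: cvgMr; have [|_ h] := mc k; [rewrite jk ltnW|exact: h].
rewrite subrr normr0 addr0 in lim.
have near_lt := cvgr_lt _ lim _ lam_small.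
suff : \forall n \near \oo, `|x - p n j| < e by [].
near=> n.
have lt_e : 'C(m, j)%:R * binomial_moment (p n) m +
    `|x - \sum_(j <= k < m)
            (-1) ^+ (k - j) * 'C(k, j)%:R * binomial_moment (p n) k| < e.
  by near: n; exact: near_lt.
apply: le_lt_trans lt_e; rewrite [leRHS]addrC; set y := \sum_(_ <= _ < _) _.
rewrite -[x - p n j](subrKA y); apply: le_trans (ler_normD _ _) _.
rewrite lerD2l; apply: bonferroni_moment => //; first by near: n.
move=> k /andP[jk km]; have km' : (k < m.+1)%N by [].
have : forall k : 'I_m.+1, (j <= k)%N -> cvgn (binomial_series (p n) k).
  by near: n.
by move=> /(_ (Ordinal km')); exact.
Unshelve. all: by end_near. Qed.

(** The moment of order k + 1 bounds the tail of the k-th uniformly in n: let n tend to infinity at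
    fixed N, then N. *)
Lemma cvg_moment_of_mass p q k (l l' : R) :
  (\forall n \near \oo, forall i, 0 <= p n i) ->
  (forall i, p n i @[n --> \oo] --> q i) ->
  moment_cvg p k l -> moment_cvg p k.+1 l' -> binomial_series q k @ \oo --> l.
Proof.
move=> p0 pq [ck lk] [ck1 lk1].
have series_lim N :
    binomial_series (p n) k N @[n --> \oo] --> binomial_series q k N.
  apply: cvg_big => [|i _]; first exact: add_continuous.
  by apply: cvgMr; exact: pq.
have tail N : (k < N)%N -> \forall n \near \oo,
   binomial_series (p n) k N <= binomial_moment (p n) k <=
   binomial_series (p n) k N + k.+1%:R / (N - k)%:R * binomial_moment (p n) k.+1.
  move=> kN; near=> n; apply: binomial_moment_tail => //; near: n => //.
have squeeze N : (k < N)%N ->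
   l - k.+1%:R / (N - k)%:R * l' <= binomial_series q k N <= l.
  move=> kN; rewrite lerBlDr; apply/andP; split; last first.
    apply: ler_cvg_to (series_lim N) lk _.
    by apply: filterS (tail N kN) => n /andP[].
  have rhs : binomial_series (p n) k N +
      k.+1%:R / (N - k)%:R * binomial_moment (p n) k.+1 @[n --> \oo] -->
      binomial_series q k N + k.+1%:R / (N - k)%:R * l'.
    by apply: cvgD => //; apply: cvgMr.
  apply: ler_cvg_to lk rhs _.
  by apply: filterS (tail N kN) => n /andP[].
apply: squeeze_cvgr (cvg_cst l).
  by exists k.+1 => // N /= kN; exact: squeeze.
(* With N = n + k + 1, the factor 1 / (N - k) becomes [harmonic n]. *)
rewrite -(cvg_shiftn k.+1) /=.
rewrite (_ : (fun n => _) = fun n => l - k.+1%:R * l' * harmonic n); last first.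
  by apply/funext => n; rewrite addnS subSn ?leq_addl// addnK /harmonic/= mulrAC.
have lim : l - k.+1%:R * l' * harmonic n @[n --> \oo] --> l - k.+1%:R * l' * 0.
  by apply: cvgB; [exact: cvg_cst|apply: cvgMr; exact: cvg_harmonic].
by rewrite mulr0 subr0 in lim.
Unshelve. all: by end_near. Qed.

(** For j >= k, C(j, k) >= 1, so the mass at j is at most the k-th moment. *)
Lemma cvg_mass0 p k :
  (\forall n \near \oo, forall i, 0 <= p n i) -> moment_cvg p k 0 ->
  forall j, (k <= j)%N -> p n j @[n --> \oo] --> 0.
Proof.
move=> p0 [ck lk] j kj; apply: squeeze_cvgr (cvg_cst 0) lk.
near=> n; have pn0 : forall i, 0 <= p n i by near: n.
rewrite pn0/=; have cn : cvgn (binomial_series (p n) k) by near: n.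
have nd := nondecreasing_binomial_series k pn0.
apply: le_trans (nondecreasing_cvgn_le nd cn j.+1).
rewrite /binomial_series /series/= big_nat_recr//= ler_wpDl//.
  by apply: sumr_ge0 => i _; rewrite mulr_ge0.
by rewrite ler_peMl// ler1n bin_gt0.
Unshelve. all: by end_near. Qed.

(** The constant 3/4 exceeds 1/2, yet stays below 4/5 so as to absorb the factor 5/4 from the
    binomial coefficients. *)
Lemma root_limsup_geometric_bound lam : (forall k, (0 < k)%N -> 0 <= lam k) ->
  (limn_esup (fun n => (lam n `^ n%:R^-1)%:E) <= (2^-1)%:E)%E ->
  \forall n \near \oo, lam n <= (3 / 4) ^+ n.
Proof.
move=> lam0 H; have : ((2^-1)%:E < (3 / 4 : R)%:E)%E by rewrite lte_fin; lra.
move=> /(le_lt_trans H) /ereal_inf_lt[_ [V FV <-] sup_lt].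
near=> n; have n0 : (0 < n)%N by near: n; exact: nbhs_infty_gt.
have Vn : V n by near: n.
have root_le : lam n `^ n%:R^-1 <= 3 / 4.
  rewrite -lee_fin; apply: le_trans (ltW sup_lt).
  by apply: ereal_sup_ubound; exists n.
have -> : lam n = (lam n `^ n%:R^-1) ^+ n.
  by rewrite -powR_mulrn ?powR_ge0// -powRrM mulVf ?pnatr_eq0 -?lt0n// powRr1 ?lam0.
by rewrite lerXn2r// ?nnegrE ?powR_ge0//; lra.
Unshelve. all: by end_near. Qed.

Lemma bin_mul_geometric_small lam j (e : R) :
  (\forall n \near \oo, lam n <= (3 / 4) ^+ n) -> 0 < e ->
  \forall m \near \oo, 'C(m, j)%:R * lam m < e.
Proof.
move=> lam_le e0.
(* [C(m, j) t^j <= (1 + t)^m] with [t = 1/4], and [5/4 * 3/4 < 1]. *)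
have bin_le m : 'C(m, j)%:R <= 4 ^+ j * (5 / 4) ^+ m :> R.
  have [mj|jm] := ltnP m j.
    by rewrite bin_small// mulr_ge0 ?exprn_ge0//; lra.
  rewrite -ler_pdivrMl ?exprn_gt0// -exprVn (_ : 5 / 4 = 1 + 4^-1); last by lra.
  rewrite exprDn (bigD1 (Ordinal (jm : (j < m.+1)%N)))//= expr1n mul1r.
  by rewrite -[leLHS]addr0 mulr_natr lerD2l sumr_ge0.
have lim : geometric (4 ^+ j) (15 / 16) m @[m --> \oo] --> (0 : R).
  by apply: cvg_geometric; rewrite ger0_norm; lra.
have small := cvgr_lt _ lim _ e0.
near=> m; apply: le_lt_trans (_ : geometric (4 ^+ j) (15 / 16) m < e).
  rewrite /geometric/= (_ : 15 / 16 = 5 / 4 * (3 / 4)); last by lra.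
  rewrite exprMn mulrA; apply: le_trans (_ : 'C(m, j)%:R * (3 / 4) ^+ m <= _).
    by rewrite ler_wpM2l//; near: m.
  by rewrite ler_wpM2r ?exprn_ge0//; lra.
by near: m; exact: small.
Unshelve. all: by end_near. Qed.

Lemma geometric_bound_summable lam :
  (forall k, (0 < k)%N -> 0 <= lam k) ->
  (\forall n \near \oo, lam n <= (3 / 4) ^+ n) ->
  (\sum_(1 <= k <oo) (lam k)%:E < +oo)%E.
Proof.
move=> lam0 [N _ lam_le].
rewrite (@nneseries_split _ _ _ N) => [|k k0]; last by rewrite lee_fin lam0.
rewrite lte_add_pinfty//; first by rewrite sumEFin ltry.
apply: (@le_lt_trans _ _ (\sum_(1 + N <= k <oo) ((3 / 4) ^+ k)%:E)%E).
  rewrite ereal_series [leRHS]ereal_series; apply: lee_nneseries => k.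
    by move=> _ kN; rewrite lee_fin lam0//; lia.
  by move=> kN; rewrite lee_fin lam_le//=; lia.
apply: (@le_lt_trans _ _ (\sum_(0 <= k <oo) ((3 / 4) ^+ k)%:E)%E).
  by rewrite ereal_series; exact: subset_lee_nneseries.
rewrite (@nneseries_EFin _ _ (1 / (1 - 3 / 4))) ?ltry//.
rewrite (_ : (fun N => _) = series (geometric 1 (3 / 4))).
  by apply: cvg_geometric_series; rewrite ger0_norm; lra.
by apply/funext => M; apply: eq_bigr => k _; rewrite /= mul1r.
Qed.

End MomentLimits.

(** * Immigration *)

Lemma moment_cvg_EFin (R : realType) (p : nat -> nat -> R) k (l : R) :
  (\forall n \near \oo, forall i, 0 <= p n i) ->
  (\sum_(j <oo) ('C(j, k)%:R * p n j)%:E @[n --> \oo] --> l%:E)%E ->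
  moment_cvg p k l.
Proof.
move=> p0 /fine_cvgP[fin lim].
have cvg_fine : \forall n \near \oo, binomial_series (p n) k @ \oo -->
    fine (\sum_(j <oo) ('C(j, k)%:R * p n j)%:E)%E.
  near=> n; have pn0 : forall i, 0 <= p n i by near: n.
  apply: cvg_nneseries_EFin => [i _|]; first by rewrite mulr_ge0.
  by rewrite fineK//; near: n.
split.
  by apply: filterS cvg_fine => n cn; apply/cvg_ex; eexists; exact: cn.
apply: cvg_trans lim; apply: near_eq_cvg.
by apply: filterS cvg_fine => n cn; rewrite /binomial_moment (cvg_lim _ cn).
Unshelve. all: by end_near. Qed.

Section DiscreteExpectation.
Context {d : measure_display} {T : measurableType d} {R : realType}.
Variable P : probability T R.

Lemma measurable_preimage_nat (X : {RV P >-> nat}) (A : set nat) :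
  measurable (X @^-1` A).
Proof. by rewrite -[_ @^-1` _]setTI; exact: (measurable_funPT X). Qed.

(** [g (X w)] is the series of [g j] times the indicator of X = j, integrated term by term by
    nonnegativity. *)
Lemma expectation_nat (X : {RV P >-> nat}) (g : nat -> R) :
  (forall j, 0 <= g j) ->
  ('E_P[fun w => g (X w)] = \sum_(j <oo) (g j)%:E * P (X @^-1` [set j]))%E.
Proof.
move=> g0; rewrite unlock.
have mX j : measurable (X @^-1` [set j]) by exact: measurable_preimage_nat.
transitivity (\int[P]_w \sum_(j <oo) ((g j)%:E * (\1_(X @^-1` [set j]) w)%:E))%E.
  apply: eq_integral => w _ /=.
  rewrite (@nneseriesD1 _ _ (X w)) => [|k _|//]; last by rewrite mule_ge0 ?lee_fin.
  rewrite indicE mem_set//= mule1 eseries0 ?adde0// => k _ kX.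
  rewrite indicE memNset ?mule0// => /= Xk.
  by rewrite Xk eqxx in kX.
rewrite integral_nneseries//.
- apply: eq_eseriesr => j _; rewrite ge0_integralZl_EFin//.
  + by rewrite integral_indic// setIT.
  + by apply/measurable_EFinP; exact: measurable_indic.
- move=> j; apply: emeasurable_funM => //; apply/measurable_EFinP.
  exact: measurable_indic.
- by move=> j w _; rewrite mule_ge0 ?lee_fin.
Qed.

End DiscreteExpectation.

Section ImmigrationMass.
Context {d : measure_display} {T : measurableType d} {R : realType}.
Variable P : probability T R.
Variables (xi0 eps : nat -> {RV P >-> nat}).

Lemma mean_defect_gt0 n : (offspring_mean xi0 n < 1)%E ->
  0 < mean_defect xi0 n.
Proof.
move=> lt1; rewrite /mean_defect subr_gt0 -lte_fin fineK//.
rewrite ge0_fin_numE; first exact: lt_trans lt1 (ltry 1).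
by apply: expectation_ge0.
Qed.

(* The mass at 0 is dropped: it is irrelevant for moments of order >= 1, and
   has no limit. *)
Definition scaled_mass n j : R :=
  if j is 0%N then 0 else fine (P (eps n @^-1` [set j])) / mean_defect xi0 n.

Lemma scaled_massE n j : (0 < j)%N ->
  (P (eps n @^-1` [set j]) * ((mean_defect xi0 n)^-1)%:E)%E =
  (scaled_mass n j)%:E.
Proof.
case: j => // j _; rewrite /= EFinM fineK ?fin_num_measure//.
exact: measurable_preimage_nat.
Qed.

Lemma scaled_mass_ge0 n j : (offspring_mean xi0 n < 1)%E ->
  0 <= scaled_mass n j.
Proof.
move=> /mean_defect_gt0 a0; case: j => //= j.
by rewrite divr_ge0 ?fine_ge0// ltW.
Qed.

Lemma factorial_moment_scaled n k : (0 < k)%N ->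
  (offspring_mean xi0 n < 1)%E ->
  (factorial_moment P (eps n) k * ((k`!%:R * mean_defect xi0 n)^-1)%:E =
   \sum_(j <oo) ('C(j, k)%:R * scaled_mass n j)%:E)%E.
Proof.
move=> k0 /mean_defect_gt0 a0; rewrite /factorial_moment.
rewrite (@expectation_nat _ _ _ _ _ (fun j => (j ^_ k)%:R))//.
rewrite muleC -nneseriesZl; last by move=> j _; rewrite mule_ge0.
apply: eq_eseriesr => -[|j] _.
  by rewrite ffact0n bin0n gtn_eqF// mul0e mule0 mul0r.
have mX := measurable_preimage_nat (eps n) [set j.+1].
rewrite -bin_ffact natrM /= -{1}[P _]fineK ?fin_num_measure// -!EFinM.
congr EFin; field.
by rewrite pnatr_eq0 -lt0n fact_gt0 lt0r_neq0.
Qed.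

Lemma immigration_moment_cvg k l : condC1 xi0 -> (0 < k)%N ->
  immigration_limit xi0 eps k l -> moment_cvg (scaled_mass) k l.
Proof.
move=> [lt1 _ _] k0 [_ lim]; apply: moment_cvg_EFin.
  by exists 1%N => // n /= n1 i; apply: scaled_mass_ge0; exact: lt1.
apply: cvg_trans lim; apply: near_eq_cvg; exists 1%N => // n /= n1.
by rewrite factorial_moment_scaled//; exact: lt1.
Qed.

End ImmigrationMass.

(** * Limit masses and the generating function in both cases *)

Section LimitMass.
Context {R : realType}.
Variable p : nat -> nat -> R.
Hypothesis p_ge0 : \forall n \near \oo, forall i, 0 <= p n i.
Hypothesis p0 : forall n, p n 0%N = 0.

Lemma mass_limit_ge0 (q : nat -> R) :
  (forall j, p n j @[n --> \oo] --> q j) -> forall j, 0 <= q j.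
Proof.
move=> pq j; rewrite -(cvg_lim (@Rhausdorff R) (pq j)); apply: limr_ge.
  by apply/cvg_ex; exists (q j); exact: pq.
by apply: filterS p_ge0 => n; exact.
Qed.

Lemma is_cvg_mass_at0 : cvgn (p^~ 0%N).
Proof.
rewrite (_ : p^~ 0%N = fun=> 0); last exact/funext.
by apply/cvg_ex; exists 0; exact: cvg_cst.
Qed.

(** The growth condition makes C(m, j) [lam m] small for large m, so the masses converge; it also
    makes [lam] summable. *)
Lemma limit_mass_infinite (nu : R) (lam : nat -> R) : 0 <= nu ->
  (forall k, (0 < k)%N -> 0 <= lam k) ->
  (forall k, (0 < k)%N -> moment_cvg p k (lam k)) ->
  (limn_esup (fun n => (lam n `^ n%:R^-1)%:E) <= (2^-1)%:E)%E ->
  exists2 q : nat -> R, forall j, p n j @[n --> \oo] --> q j &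
    forall s, 0 <= s <= 1 -> cvgn (limit_partial_sum nu lam s) /\
      (limit_pgf nu None lam s)%:E = limit_exp_series nu q s.
Proof.
move=> nu0 lam0 mc growth; have lam_le := root_limsup_geometric_bound lam0 growth.
have pc j : cvgn (p^~ j).
  case: j => [|j]; first exact: is_cvg_mass_at0.
  apply: (@cvg_mass_of_moments _ _ lam) => // e e0.
  have [N _ small] := bin_mul_geometric_small j.+1 lam_le e0.
  exists (maxn N j.+1); split; first exact: leq_maxr.
    by move=> k /andP[jk _]; apply: mc; exact: leq_ltn_trans jk.
  by apply: small; exact: leq_maxl.
pose q j := limn (p^~ j); have pq j : p n j @[n --> \oo] --> q j by exact: pc.
exists q => //; apply: limit_pgf_series => //.
- exact: mass_limit_ge0.
- move=> k k0; apply: nneseries_EFin.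
  by apply: (cvg_moment_of_mass p_ge0 pq (mc k k0)); exact: mc.
- exact: geometric_bound_summable.
Qed.

(** As [lam K] = 0, the Bonferroni error with m = K vanishes in the limit, and so do the masses at j
    >= K. *)
Lemma limit_mass_finite (nu : R) (K : nat) (lam : nat -> R) : 0 <= nu ->
  (0 < K)%N ->
  (forall k, (0 < k <= K)%N -> moment_cvg p k (lam k)) -> lam K = 0 ->
  exists2 q : nat -> R, forall j, p n j @[n --> \oo] --> q j &
    forall s, 0 <= s <= 1 ->
      (limit_pgf nu (Some K) lam s)%:E = limit_exp_series nu q s.
Proof.
move=> nu0 K0 mc lamK.
have mcK : moment_cvg p K 0 by rewrite -lamK; apply: mc; rewrite K0 leqnn.
have pc j : cvgn (p^~ j).
  case: j => [|j]; first exact: is_cvg_mass_at0.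
  have [jK|Kj] := leqP j.+1 K; last first.
    by apply/cvg_ex; exists 0; apply: cvg_mass0 mcK _ _ => //; exact: ltnW.
  apply: (@cvg_mass_of_moments _ _ lam) => // e e0.
  exists K; split => //; last by rewrite lamK mulr0.
  by move=> k /andP[jk kK]; apply: mc; rewrite kK (leq_ltn_trans _ jk).
pose q j := limn (p^~ j); have pq j : p n j @[n --> \oo] --> q j by exact: pc.
have qK j : (K <= j)%N -> q j = 0.
  by move=> Kj; apply: cvg_lim => //; exact: cvg_mass0 mcK _ Kj.
(* Extension by zero reduces to the infinite series: for k >= K, either j < k and C(j, k) = 0, or j
   >= K and [q j] = 0. *)
pose lam' k := if (k < K)%N then lam k else 0.
exists q => // s s01.
have [|k k0||_ <-] := @limit_pgf_series _ nu lam' q nu0 _ _ _ s s01.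
- exact: mass_limit_ge0.
- rewrite /lam'; case: ltnP => [kK|Kk].
    apply: nneseries_EFin; apply: cvg_moment_of_mass p_ge0 pq (mc k _) (mc k.+1 _).
      by rewrite k0 ltnW.
    by rewrite kK.
  apply: eseries0 => j _ _; have [Kj|jK] := leqP K j; first by rewrite qK// mulr0.
  by rewrite bin_small ?mul0r// (leq_trans jK).
- rewrite ereal_series (@eseries_fin _ _ _ K) => [|k Kk]; last first.
    by rewrite /lam' ltnNge Kk.
  by rewrite sumEFin ltry.
rewrite /limit_pgf; congr (expR (- _))%:E; apply/esym/lim_near_cst => //.
exists K => // N /= KN; rewrite /limit_partial_sum (big_cat_nat _ (n := K))//=.
rewrite [X in _ + X](_ : _ = 0) ?addr0; last first.
  rewrite big_nat big1// => k /andP[Kk _].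
  by rewrite limit_termE /lam' ltnNge Kk mul0r.
by apply: eq_big_nat => k /andP[_ kK]; rewrite !limit_termE /lam' kK.
Qed.

End LimitMass.

Theorem theorem4 (R : realType) (d : measure_display) (T : measurableType d)
  (P : probability T R)
  (xi0 : nat -> {RV P >-> nat}) (xi : nat -> nat -> {RV P >-> nat})
  (eps : nat -> {RV P >-> nat})
  (nu : R) (K : option nat) (lam : nat -> R)
  (gw : gw_data xi0 xi eps)
  (C1 : condC1 xi0) (C2 : condC2 xi0 nu) (C3 : condC3 xi0 nu)
  (imm : immigration_cond xi0 eps K lam) :
  exists q : nat -> R,
    [/\ forall j, (1 <= j)%N ->
          (P (eps n @^-1` [set j]) * ((mean_defect xi0 n)^-1)%:E)%E
            @[n --> \oo] --> (q j)%:E,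
        forall s : R, 0 <= s <= 1 ->
          (K = None -> cvgn (limit_partial_sum nu lam s)) /\
          (limit_pgf nu K lam s)%:E = limit_exp_series nu q s
      & forall (d' : measure_display) (T' : measurableType d')
            (Q : probability T' R) (Y : {RV Q >-> nat}),
          cvg_in_law P (gw_process xi eps) Q Y ->
          (forall s : R, 0 <= s <= 1 -> pgf Q Y s = (limit_pgf nu K lam s)%:E) ->
          forall s : R, 0 <= s <= 1 -> pgf Q Y s = limit_exp_series nu q s].
Proof.
have [nu0 _] := C2.
(* Everything reduces to limits of the scaled masses and the identity of the two exponents; the
   formula for [Y] then follows by substitution. *)
suff [q pq qE] : exists2 q : nat -> R,
    forall j, scaled_mass xi0 eps n j @[n --> \oo] --> q j &
    forall s, 0 <= s <= 1 -> (K = None -> cvgn (limit_partial_sum nu lam s)) /\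
      (limit_pgf nu K lam s)%:E = limit_exp_series nu q s.
  exists q; split=> // [j j0|d' T' Q Y _ pgfE s s01]; last first.
    by rewrite pgfE//; have [_] := qE s s01.
  under eq_cvg do rewrite scaled_massE//.
  by apply: cvg_EFin; [exact: nearW|exact: pq].
have p_ge0 : \forall n \near \oo, forall i, 0 <= scaled_mass xi0 eps n i.
  have [lt1 _ _] := C1.
  by exists 1%N => // n /= n1 i; apply: scaled_mass_ge0; exact: lt1.
case: K imm => [K [K1 lim lamK]|[lim growth]].
  have [||q pq qE] := limit_mass_finite p_ge0 _ nu0 K1 _ lamK => //.
    move=> k kK; apply: immigration_moment_cvg => //; last exact: lim.
    by case/andP: kK.
  by exists q => // s /qE.
have [|||q pq qE] := limit_mass_infinite p_ge0 _ nu0 _ _ growth => //.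
- by move=> k k0; have [] := lim k k0.
- by move=> k k0; apply: immigration_moment_cvg => //; exact: lim.
- by exists q => // s /qE[].
Qed.
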